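(* Let $X\subseteq\mathbb{P}^n(\overline{\mathbb{F}}_q)$ be a projective variety defined over a finite field $\mathbb{F}_q$, with vanishing ideal $I_{\overline{\mathbb{F}}_q}(X)=\langle f_1,\ldots,f_M,g_1,\ldots,g_N\rangle_{\overline{\mathbb{F}}_q}\subseteq\overline{\mathbb{F}}_q[x_0,\ldots,x_n]$, where $f_i,g_j\in\mathbb{F}_q[x_0,\ldots,x_n]$ are homogeneous with $\deg f_i\geq 2$ and $\deg g_j=1$. Let $J=\langle f_i,\,g_j,\,x_k^q-x_k : 1\le i\le M,\ 1\le j\le N,\ 0\leq k\leq n\rangle_{\overline{\mathbb{F}}_q}$. If $h$ is a homogeneous linear form with coefficients in $\mathbb{F}_q$ such that $h^q-h\in J$ and $h\in\sqrt{J}$, then $h^q\in J$.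
   Context: $\mathbb{F}_q$ is a finite field with $q$ elements and $\overline{\mathbb{F}}_q$ is an algebraic closure. A projective variety $X\subseteq\mathbb{P}^n(\overline{\mathbb{F}}_q)$ is defined over $\mathbb{F}_q$ if its vanishing ideal can be generated by polynomials with coefficients in $\mathbb{F}_q$. The notation $\langle\cdots\rangle_{\overline{\mathbb{F}}_q}$ means the ideal generated in $\overline{\mathbb{F}}_q[x_0,\ldots,x_n]$, and $\sqrt{J}$ is the radical of $J$ in this ring. *)

(* Defs.v *)
From HB Require Import structures.
From mathcomp Require Import all_boot all_order all_algebra.
From mathcomp Require Import mpoly.

Set Implicit Arguments.
Unset Strict Implicit.
Unset Printing Implicit Defensive.

Import GRing.Theory.
Local Open Scope ring_scope.

Section Ideals.
Variable R : comNzRingType.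

(* The list [s] pairs each coefficient with a generator, so the empty list
   gives 0 and [ideal_gen S] is an ideal even when [S] is empty. *)
Definition ideal_gen (S : R -> Prop) (p : R) : Prop :=
  exists2 s : seq (R * R),
    (forall c, c \in s -> S c.2) & p = \sum_(c <- s) c.1 * c.2.

Definition radical (J : R -> Prop) (p : R) : Prop :=
  exists2 m : nat, (0 < m)%N & J (p ^+ m).

End Ideals.

Definition is_algebraic_closure (F : fieldType) (K : closedFieldType)
    (iota : {rmorphism F -> K}) : Prop :=
  forall x : K, algebraicOver iota x.

Section Projective.
Variables (K : fieldType) (n : nat).

(* P^n(K) as the set of lines through the origin of K^(n+1). *)
Definition proj_space : Type := {L : {vspace 'rV[K]_n.+1} | \dim L == 1%N}.

(* The nonzero vectors [v] of the line are the homogeneous coordinates of the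
   point; this is meant for homogeneous [p]. *)
Definition vanishes_at (p : {mpoly K[n.+1]}) (P : proj_space) : Prop :=
  forall v : 'rV[K]_n.+1, v \in sval P -> v != 0 -> p.@[v 0] = 0.

Definition zero_locus (S : {mpoly K[n.+1]} -> Prop) (P : proj_space) : Prop :=
  forall p, S p -> vanishes_at p P.

(* A projective variety is a Zariski closed subset of P^n(K); irreducibility is
   not part of the definition. *)
Definition projective_variety (X : proj_space -> Prop) : Prop :=
  exists2 S : {mpoly K[n.+1]} -> Prop,
    (forall p, S p -> p \is ishomog mdeg)
    & (forall P, X P <-> zero_locus S P).

Definition vanishing_ideal (X : proj_space -> Prop) : {mpoly K[n.+1]} -> Prop :=
  ideal_gen (fun p => p \is ishomog mdeg /\
                      forall P, X P -> vanishes_at p P).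

End Projective.

Section BaseField.
Variables (F : fieldType) (K : fieldType) (iota : {rmorphism F -> K}).
Variable n : nat.

Definition base_image (S : {mpoly F[n.+1]} -> Prop) (p : {mpoly K[n.+1]}) :
    Prop :=
  exists2 s, S s & p = map_mpoly iota s.

Definition defined_over (X : proj_space K n -> Prop) : Prop :=
  exists S : {mpoly F[n.+1]} -> Prop,
    forall p, vanishing_ideal X p <-> ideal_gen (base_image S) p.

Definition family_gens (M N : nat) (f : 'I_M -> {mpoly F[n.+1]})
    (g : 'I_N -> {mpoly F[n.+1]}) : {mpoly F[n.+1]} -> Prop :=
  fun p => (exists i, p = f i) \/ (exists j, p = g j).

Definition family_gens_q (q : nat) (M N : nat) (f : 'I_M -> {mpoly F[n.+1]})
    (g : 'I_N -> {mpoly F[n.+1]}) : {mpoly F[n.+1]} -> Prop :=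
  fun p => family_gens f g p \/ (exists k : 'I_n.+1, p = 'X_k ^+ q - 'X_k).

End BaseField.

(* Main.v *)
(* Modulo J one has h = h^q with q >= 2, so h^(m+2) in J gives
   h^(m+1) = h^m h = h^m h^q = h^(m+2) h^(q-2) = 0; hence h^m in J descends to
   h in J. *)
Require Import Defs.
From HB Require Import structures.
From mathcomp Require Import all_boot all_order all_algebra.
From mathcomp Require Import mpoly.

Set Implicit Arguments.
Unset Strict Implicit.
Unset Printing Implicit Defensive.

Import GRing.Theory.
Local Open Scope ring_scope.

(** In the quotient by $J$ the class of $h$ is nilpotent and equals its own $q$-th power. Since $q
    \ge 2$, trading one factor $h$ for $h^q$ turns a power of $h$ into a multiple of the next power,
    so vanishing passes down from $h^{m+2}$ to $h^{m+1}$, and finally to $h$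
    ([ideal_gen_radical_expB]). Then $h^q = (h^q - h) + h$ is in $J$. *)

Section IdealGen.
Variables (R : comNzRingType) (S : R -> Prop).

Lemma ideal_genD (a b : R) :
  ideal_gen S a -> ideal_gen S b -> ideal_gen S (a + b).
Proof.
move=> [s Ss ->] [t St ->]; exists (s ++ t); last by rewrite big_cat.
by move=> c; rewrite mem_cat => /orP[/Ss | /St].
Qed.

Lemma ideal_genMl (a b : R) : ideal_gen S b -> ideal_gen S (a * b).
Proof.
move=> [s Ss ->]; exists [seq (a * c.1, c.2) | c <- s].
  by move=> c /mapP[d /Ss Sd ->].
by rewrite big_map mulr_sumr; apply: eq_bigr => c _; rewrite mulrA.
Qed.

Lemma ideal_genB (a b : R) :
  ideal_gen S a -> ideal_gen S b -> ideal_gen S (a - b).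
Proof. by move=> Sa Sb; rewrite -mulN1r; apply/ideal_genD/ideal_genMl. Qed.

Lemma ideal_gen_radical_expB (q : nat) (a : R) : (1 < q)%N ->
  ideal_gen S (a ^+ q - a) -> radical (ideal_gen S) a -> ideal_gen S a.
Proof.
(* From here [q] stands for the original exponent minus 2, and the exponent given by the radical is
   [m.+1]. *)
case: q => [|[|q]] // _ Saq [[|m] // _]; elim: m => [|m IHm] // Sam.
apply: IHm.
(* The first product is a multiple of [a ^+ m.+2], the second of [a ^+ q.+2 - a], and both of these
   lie in the ideal. *)
have -> : a ^+ m.+1 = a ^+ q * a ^+ m.+2 - a ^+ m * (a ^+ q.+2 - a).
  by rewrite mulrBr -!exprD -exprSr !addnS addnC opprB addrCA subrr addr0.
by apply: ideal_genB; apply: ideal_genMl.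
Qed.

End IdealGen.

Theorem proposition2p6 (F : finFieldType) (q : nat) (hq : #|F| = q)
    (K : closedFieldType) (iota : {rmorphism F -> K})
    (hiota : is_algebraic_closure iota)
    (n : nat) (X : proj_space K n -> Prop)
    (hX : projective_variety X) (hXF : defined_over iota X)
    (M N : nat)
    (f : 'I_M -> {mpoly F[n.+1]}) (g : 'I_N -> {mpoly F[n.+1]})
    (hf : forall i, exists2 d, (2 <= d)%N & f i \is d.-homog)
    (hg : forall j, g j \is 1.-homog)
    (hI : forall p, vanishing_ideal X p <->
                    ideal_gen (base_image iota (family_gens f g)) p)
    (h : {mpoly F[n.+1]}) (hh : h \is 1.-homog) :
  let J := ideal_gen (base_image iota (family_gens_q q f g)) in
  let hK := map_mpoly iota h in
  J (hK ^+ q - hK) -> radical J hK -> J (hK ^+ q).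
Proof.
move=> J hK Jq Jrad; have q_gt1 : (1 < q)%N.
  (* A field has the two distinct elements 0 and 1. *)
  by rewrite -hq; apply/card_gt1P; exists 0, 1; rewrite // eq_sym oner_eq0.
rewrite -(subrK hK (hK ^+ q)); apply: ideal_genD => //.
exact: ideal_gen_radical_expB Jq Jrad.
Qed.
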